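(* Let $(\Lambda,d)$ be a finitely aligned $k$-graph. Let $\big\{t_\lambda:\lambda\in\big(\bigcup_{i=1}^k\Lambda^{e_i}\big)\cup\Lambda^0\big\}$ be a family of partial isometries in a $C^*$-algebra. Then there is at most one Cuntz-Krieger $\Lambda$-family $\{t'_\lambda:\lambda\in\Lambda\}$ (in the same $C^*$-algebra) such that $t'_\lambda=t_\lambda$ for all $\lambda\in\big(\bigcup_{i=1}^k\Lambda^{e_i}\big)\cup\Lambda^0$. Furthermore, such a Cuntz-Krieger $\Lambda$-family exists if and only if (i) $\{t_v:v\in\Lambda^0\}$ is a collection of mutually orthogonal projections; (ii) $t_\lambda t_\alpha=t_\mu t_\beta$ when $\lambda,\mu,\alpha,\beta\in\big(\bigcup_{i=1}^k\Lambda^{e_i}\big)\cup\Lambda^0$ satisfy $\lambda\alpha=\mu\beta$; (iii) $t_\lambda^*t_\mu=\sum_{(\alpha,\beta)\in\Lambda^{\min}(\lambda,\mu)}t_\alpha t_\beta^*$ for all $\lambda,\mu\in\bigcup_{i=1}^k\Lambda^{e_i}$; and (iv) for every $v\in\Lambda^0$ and every finite exhaustive $E\subset\bigcup_{i=1}^kv\Lambda^{e_i}$, $\ \prod_{\lambda\in E}(t_v-t_\lambda t_\lambda^* )=0$.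
   Context: Conventions: $0\in\mathbb{N}$; $\mathbb{N}^k$ is a semigroup with generators $e_1,\dots,e_k$, coordinatewise partial order $\le$, and $m\vee n$ denotes the coordinatewise maximum. A $k$-graph $(\Lambda,d)$ is a countable small category $\Lambda$ with a functor $d:\Lambda\to\mathbb{N}^k$ satisfying the factorisation property: if $d(\lambda)=m+n$ there are unique $\mu,\sigma\in\Lambda$ with $d(\mu)=m$, $d(\sigma)=n$, $\lambda=\mu\sigma$. Morphisms are called paths, objects vertices; $s$ and $r$ are the domain and codomain maps, so $\lambda\mu$ is defined when $s(\lambda)=r(\mu)$. $\Lambda^n:=\{\lambda:d(\lambda)=n\}$, and objects are identified with $\Lambda^0$. For $v\in\Lambda^0$, $v\Lambda:=\{\lambda\in\Lambda:r(\lambda)=v\}$ and $v\Lambda^n:=v\Lambda\cap\Lambda^n$. For $\lambda,\mu\in\Lambda$, $\Lambda^{\min}(\lambda,\mu):=\{(\alpha,\beta):\lambda\alpha=\mu\beta,\ d(\lambda\alpha)=d(\lambda)\vee d(\mu)\}$. $\Lambda$ is finitely aligned if every $\Lambda^{\min}(\lambda,\mu)$ is finite (possibly empty). A set $E\subset v\Lambda$ is exhaustive if for every $\mu\in v\Lambda$ there is $\lambda\in E$ with $\Lambda^{\min}(\lambda,\mu)\ne\emptyset$. A Cuntz-Krieger $\Lambda$-family is a collection $\{t_\lambda:\lambda\in\Lambda\}$ of partial isometries in a $C^*$-algebra such that (i) $\{t_v:v\in\Lambda^0\}$ are mutually orthogonal projections; (ii) $t_\lambda t_\mu=t_{\lambda\mu}$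 whenever $s(\lambda)=r(\mu)$; (iii) $t_\lambda^*t_\mu=\sum_{(\alpha,\beta)\in\Lambda^{\min}(\lambda,\mu)}t_\alpha t_\beta^*$ for all $\lambda,\mu\in\Lambda$; (iv) $\prod_{\lambda\in E}(t_v-t_\lambda t_\lambda^* )=0$ for all $v\in\Lambda^0$ and all finite exhaustive $E\subset v\Lambda$. *)

(* Defs.v *)
From HB Require Import structures.
From mathcomp Require Import all_boot all_order all_algebra.
From mathcomp Require Import complex.
From mathcomp Require Import all_classical all_reals all_analysis.

Set Implicit Arguments.
Unset Strict Implicit.
Unset Printing Implicit Defensive.

Import Order.TTheory GRing.Theory Num.Theory.
Import numFieldNormedType.Exports.

Local Open Scope classical_set_scope.
Local Open Scope ring_scope.

(* A C*-algebra is not assumed to be unital, so its multiplication cannot be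
   the one of the ring structures of the library. *)
HB.mixin Record CompleteNormedModule_isCstarAlgebra (R : realType) A
    of CompleteNormedModule R[i] A := {
  cmul : A -> A -> A;
  star : A -> A;
  cmulA : associative cmul;
  cmulDl : left_distributive cmul +%R;
  cmulDr : right_distributive cmul +%R;
  cscalerAl : forall (c : R[i]) (a b : A), cmul (c *: a) b = c *: cmul a b;
  cscalerAr : forall (c : R[i]) (a b : A), cmul a (c *: b) = c *: cmul a b;
  cnorm_mul : forall a b : A, `|cmul a b| <= `|a| * `|b|;
  starK : involutive star;
  starD : {morph star : a b / a + b};
  starZ : forall (c : R[i]) (a : A), star (c *: a) = Num.conj c *: star a;
  starM : forall a b : A, star (cmul a b) = cmul (star b) (star a);
  cnorm_star : forall a : A, `|cmul (star a) a| = `|a| ^+ 2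
}.

#[short(type="cstarAlgType")]
HB.structure Definition CstarAlgebra (R : realType) :=
  {A of CompleteNormedModule_isCstarAlgebra R A & CompleteNormedModule R[i] A}.

Notation "a ** b" := (cmul a b) (at level 40, left associativity) : ring_scope.
Notation "a ^*s" := (star a) (at level 2, format "a ^*s") : ring_scope.

Section CstarNotions.
Variables (R : realType) (A : cstarAlgType R).

Definition projection (p : A) : Prop := p^*s = p /\ p ** p = p.

Definition partial_isometry (a : A) : Prop := a ** a^*s ** a = a.

(* Product of a nonempty sequence. There is no unit to serve as the empty
   product; the value 0 is a dummy, and only products over exhaustive sets,
   which are never empty, are used below. *)
Definition cmul_seq (s : seq A) : A :=
  if s is a :: s' then foldl (fun x y => x ** y) a s' else 0.

End CstarNotions.

Notation degree k := {ffun 'I_k -> nat}.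

Definition unit_degree {k : nat} (i : 'I_k) : degree k := [ffun j => nat_of_bool (j == i)].

Definition degree_join {k : nat} (m n : degree k) : degree k :=
  [ffun i => maxn (m i) (n i)].

(* The countable category is given by its objects (vertices) and its morphisms
   (paths), with source = domain and range = codomain. Composition is a total
   function whose value [pathcomp l m] is meaningful only if [src l = rng m]. An
   object v is identified with the path [idp v]. *)
Record kgraph (k : nat) := KGraph {
  vertex : countType;
  gpath :> countType;
  src : gpath -> vertex;
  rng : gpath -> vertex;
  idp : vertex -> gpath;
  pathcomp : gpath -> gpath -> gpath;
  src_idp : forall v, src (idp v) = v;
  rng_idp : forall v, rng (idp v) = v;
  src_pathcomp : forall l m, src l = rng m -> src (pathcomp l m) = src m;
  rng_pathcomp : forall l m, src l = rng m -> rng (pathcomp l m) = rng l;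
  pathcomp_idl : forall l, pathcomp (idp (rng l)) l = l;
  pathcomp_idr : forall l, pathcomp l (idp (src l)) = l;
  pathcompA : forall l m n, src l = rng m -> src m = rng n ->
    pathcomp l (pathcomp m n) = pathcomp (pathcomp l m) n;
  deg : gpath -> degree k;
  deg_idp : forall v, deg (idp v) = 0;
  deg_pathcomp : forall l m, src l = rng m -> deg (pathcomp l m) = deg l + deg m;
  factorisation : forall l (m n : degree k), deg l = m + n ->
    exists! p : gpath * gpath,
      [/\ deg p.1 = m, deg p.2 = n, src p.1 = rng p.2 & l = pathcomp p.1 p.2]
}.

Section KGraphNotions.
Variables (k : nat) (L : kgraph k).
Implicit Types (l m : L) (v w : vertex L).

Definition is_edge l : Prop := exists i : 'I_k, deg l = unit_degree i.

Definition edge_or_vertex l : Prop := is_edge l \/ deg l = 0.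

Definition Lmin l m : set (L * L) :=
  [set p | [/\ src l = rng p.1, src m = rng p.2, pathcomp l p.1 = pathcomp m p.2
             & deg (pathcomp l p.1) = degree_join (deg l) (deg m)]].

Definition finitely_aligned : Prop := forall l m, finite_set (Lmin l m).

Definition exhaustive v (E : set L) : Prop :=
  (forall l, E l -> rng l = v) /\
  (forall m, rng m = v -> exists2 l, E l & Lmin l m !=set0).

Variables (R : realType) (A : cstarAlgType R).
Implicit Type t : L -> A.

Definition orthogonal_vertex_projections t : Prop :=
  (forall v, projection (t (idp v))) /\
  (forall v w, v <> w -> t (idp v) ** t (idp w) = 0).

(* The factors of the product commute as soon as the relations on
   [t_l^* t_m] hold; finite sets are enumerated by duplicate-free sequences
   and the product is required to vanish for every enumeration. *)
Definition gap_product t v (E : seq L) : A :=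
  cmul_seq [seq t (idp v) - t l ** (t l)^*s | l <- E].

Definition cuntz_krieger_family t : Prop :=
  (forall l, partial_isometry (t l)) /\
  [/\ orthogonal_vertex_projections t,
      forall l m, src l = rng m -> t l ** t m = t (pathcomp l m),
      forall l m,
        (t l)^*s ** t m = \sum_(p \in Lmin l m) t p.1 ** (t p.2)^*s
    & forall v (E : seq L), uniq E -> exhaustive v [set` E] ->
        gap_product t v E = 0].

End KGraphNotions.

(* Main.v *)
Require Import Defs.
From HB Require Import structures.
From mathcomp Require Import all_boot all_order all_algebra.
From mathcomp Require Import complex.
From mathcomp Require Import all_classical all_reals all_analysis.
From mathcomp Require Import zify.

Set Implicit Arguments.
Unset Strict Implicit.
Unset Printing Implicit Defensive.

Import Order.TTheory GRing.Theory Num.Theory.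
Import numFieldNormedType.Exports.

Local Open Scope classical_set_scope.
Local Open Scope ring_scope.

(* A path is a product of edges, so a multiplicative family is determined by its
   values on edges and vertices; conversely any two factorisations of a path
   into edges are connected by commuting squares, so the square relation makes
   the product of the edge values well defined. The relation on t_l^* t_m
   propagates from edges to paths because Lmin(l, mn) is the disjoint union over
   (a, b) in Lmin(l, m) of copies of Lmin(b, n).

   For finite exhaustive E, the vanishing of the gap product over E means that no
   nonzero y in t_v A is annihilated by all t_l^*, l in E. The first edges of
   the paths of E are again exhaustive, so it suffices that t_g^* y = 0 for every
   first edge g; this follows by induction on a common bound of the degrees in
   E, since t_g^* y is annihilated by the minimal extensions of g towards E. *)

(** * Paths, their lengths and minimal common extensions *)

Section Paths.
Variables (k : nat) (L : kgraph k).
Implicit Types (l m e : L) (v : vertex L).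

Lemma degree_addE (m n : degree k) i : (m + n) i = (m i + n i)%N.
Proof. by rewrite !ffunE. Qed.

(** Both [(idp (rng l), l)] and [(l, idp (src l))] factor [l] in degrees 0 + 0, so uniqueness
    identifies them. *)
Lemma deg0_idp l : deg l = 0 -> l = idp (rng l).
Proof.
move=> l0; have dl : deg l = 0 + 0 by rewrite addr0.
have [p [_ pu]] := factorisation dl.
have e1 : p = (idp (rng l), l).
  by apply: pu; split; rewrite /= ?deg_idp ?src_idp ?pathcomp_idl.
have e2 : p = (l, idp (src l)).
  by apply: pu; split; rewrite /= ?deg_idp ?rng_idp ?pathcomp_idr.
by move: e2; rewrite e1 => -[].
Qed.

Lemma edge_or_vertex_idp v : edge_or_vertex (idp v).
Proof. by right; exact: deg_idp. Qed.

Lemma edge_or_vertexP l :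
  edge_or_vertex l <-> is_edge l \/ exists v, l = idp v.
Proof.
split=> -[le|]; [by left|by move=> /deg0_idp ->; right; eexists|by left|].
by move=> [v ->]; exact: edge_or_vertex_idp.
Qed.

Lemma initial_segment l (n : degree k) : (forall i, n i <= deg l i)%N ->
  exists p q, [/\ deg p = n, src p = rng q & l = pathcomp p q].
Proof.
move=> nl; have dl : deg l = n + [ffun i => deg l i - n i]%N.
  by apply/ffunP => i; rewrite degree_addE ffunE subnKC.
by have [[p q] [[/= ? ? ? ?] _]] := factorisation dl; exists p, q.
Qed.

(** The degrees of the tails agree by cancellation, so both pairs are the unique factorisation of
    one path. *)
Lemma pathcomp_inj p q p' q' :
  src p = rng q -> src p' = rng q' -> deg p = deg p' ->
  pathcomp p q = pathcomp p' q' :> L -> p = p' /\ q = q'.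
Proof.
move=> pq pq' dp e; have dl := deg_pathcomp pq.
have [x [_ xu]] := factorisation dl.
have e1 : x = (p, q) by apply: xu.
have e2 : x = (p', q').
  apply: xu; split => //=; apply/ffunP => i.
  have := congr1 (fun d : degree k => d i) dl.
  rewrite e (deg_pathcomp pq') !degree_addE dp => /eqP.
  by rewrite eqn_add2l => /eqP.
by move: e2; rewrite e1 => -[].
Qed.

Lemma pathcompI l p q : src l = rng p -> src l = rng q ->
  pathcomp l p = pathcomp l q -> p = q.
Proof. by move=> lp lq /(pathcomp_inj lp lq erefl)[]. Qed.

Lemma first_edge l i : (0 < deg l i)%N ->
  exists e m, [/\ deg e = unit_degree i, src e = rng m & l = pathcomp e m].
Proof.
move=> li; apply: initial_segment => j.
by rewrite ffunE; case: eqP => [->|].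
Qed.

Definition path_length l : nat := (\sum_i deg l i)%N.

Lemma path_length_edge e m : is_edge e -> src e = rng m ->
  path_length (pathcomp e m) = (path_length m).+1.
Proof.
move=> [i ei] em; rewrite /path_length deg_pathcomp// ei.
rewrite (bigD1 i)//= [in RHS](bigD1 i)//= degree_addE ffunE eqxx add1n.
rewrite addSn; congr ((_ + _).+1); apply: eq_bigr => j ji.
by rewrite degree_addE ffunE (negPf ji).
Qed.

Lemma path_ind (P : L -> Prop) :
  (forall v, P (idp v)) ->
  (forall e m, is_edge e -> src e = rng m -> P m -> P (pathcomp e m)) ->
  forall l, P l.
Proof.
move=> Pid Pedge l; have [n] := ubnP (path_length l).
elim: n l => // n IH l; rewrite ltnS => ln.
have [l0|] := pselect (forall i, deg l i = 0%N).
  by rewrite (deg0_idp (l := l)) //; apply/ffunP => i; rewrite l0 ffunE.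
move=> /existsNP[i /eqP]; rewrite -lt0n => /first_edge[e [m [de em le]]].
have ee : is_edge e by exists i.
rewrite le; apply: Pedge => //; apply: IH; apply: leq_trans ln.
by rewrite le path_length_edge.
Qed.

(** Truncating the common extension at the join of the degrees leaves initial segments of [x] and
    [y]; unique factorisation identifies the two truncated paths and the two tails. *)
Lemma Lmin_common_extension l m x y :
  src l = rng x -> src m = rng y -> pathcomp l x = pathcomp m y ->
  exists p w, [/\ Lmin l m p, src p.1 = rng w,
                  x = pathcomp p.1 w & y = pathcomp p.2 w].
Proof.
move=> lx my e.
have de i : (deg l i + deg x i = deg m i + deg y i)%N.
  by rewrite -!degree_addE -!deg_pathcomp// e.
have [|a [w [da aw xaw]]] :=
    @initial_segment x [ffun i => degree_join (deg l) (deg m) i - deg l i]%N.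
  by move=> i; rewrite !ffunE; have := de i; lia.
have [|b [w' [db bw' ybw']]] :=
    @initial_segment y [ffun i => degree_join (deg l) (deg m) i - deg m i]%N.
  by move=> i; rewrite !ffunE; have := de i; lia.
have la : src l = rng a by rewrite lx xaw rng_pathcomp.
have mb : src m = rng b by rewrite my ybw' rng_pathcomp.
have dla : deg (pathcomp l a) = degree_join (deg l) (deg m).
  apply/ffunP => i; rewrite deg_pathcomp// degree_addE da !ffunE; lia.
have [||||lamb ww'] := @pathcomp_inj (pathcomp l a) w (pathcomp m b) w'.
- by rewrite src_pathcomp.
- by rewrite src_pathcomp.
- rewrite dla; apply/ffunP => i.
  rewrite deg_pathcomp// degree_addE db !ffunE; lia.
- by rewrite -!pathcompA// -xaw -ybw'.
by exists (a, b), w; split => //=; rewrite ybw' ww'.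
Qed.

Lemma Lmin_sym l m p : Lmin l m p -> Lmin m l (p.2, p.1).
Proof.
case=> lp mp e d; split => //=; rewrite -e d.
by apply/ffunP => i; rewrite !ffunE maxnC.
Qed.

Lemma Lmin_src l m p : Lmin l m p -> src p.1 = src p.2.
Proof. by case=> lp mp e _; rewrite -(src_pathcomp lp) e src_pathcomp. Qed.

Lemma Lmin_deg1 l m p i : Lmin l m p ->
  deg p.1 i = (deg m i - deg l i)%N.
Proof.
case=> lp mp e /(congr1 (fun d : degree k => d i)).
rewrite deg_pathcomp// degree_addE !ffunE; lia.
Qed.

Lemma Lmin_deg2 l m p i : Lmin l m p ->
  deg p.2 i = (deg l i - deg m i)%N.
Proof. by move=> /Lmin_sym /(Lmin_deg1 i). Qed.

Lemma Lmin_inj2 l m p q : Lmin l m p -> Lmin l m q -> p.2 = q.2 -> p = q.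
Proof.
case: p q => [a b] [a' b'] [/= la mb e _] [/= la' _ e' _] bb; subst b'.
by congr pair; apply: (@pathcompI l) => //; rewrite e.
Qed.

Lemma Lmin_inj1 l m p q : Lmin l m p -> Lmin l m q -> p.1 = q.1 -> p = q.
Proof.
move=> /Lmin_sym lp /Lmin_sym lq e; have [] := Lmin_inj2 lp lq e.
by case: p q {lp lq} e => [? ?] [? ?] /= -> ->.
Qed.

(** Only 0 and the unit degree itself lie below a unit degree. *)
Lemma edge_or_vertex_sub l m : edge_or_vertex m ->
  (forall i, deg l i <= deg m i)%N -> edge_or_vertex l.
Proof.
move=> [[i em]|m0] lm; last first.
  by right; apply/ffunP => j; have := lm j; rewrite m0 !ffunE leqn0 => /eqP.
have [li|li] := posnP (deg l i); [right|left; exists i]; apply/ffunP => j;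
  have := lm j; rewrite em !ffunE; case: eqP => [->|_] /=; lia.
Qed.

Lemma Lmin_edge_or_vertex1 l m p : edge_or_vertex m -> Lmin l m p ->
  edge_or_vertex p.1.
Proof.
move=> em lmp; apply: edge_or_vertex_sub em _ => i.
by rewrite (Lmin_deg1 _ lmp) leq_subr.
Qed.

Lemma Lmin_edge_or_vertex2 l m p : edge_or_vertex l -> Lmin l m p ->
  edge_or_vertex p.2.
Proof. by move=> el /Lmin_sym/(Lmin_edge_or_vertex1 el). Qed.

Lemma Lmin_idp m : Lmin (idp (rng m)) m = [set (m, idp (src m))].
Proof.
apply/seteqP; split => [[a b] lp|_ ->]; last first.
  split; rewrite /= ?src_idp ?rng_idp ?pathcomp_idl ?pathcomp_idr//.
  by apply/ffunP => i; rewrite deg_idp !ffunE max0n.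
have b0 : deg b = 0.
  by apply/ffunP => i; rewrite (Lmin_deg2 i lp) deg_idp ffunE.
case: lp => /=; rewrite src_idp => ra mb; rewrite ra pathcomp_idl.
by rewrite (deg0_idp b0) -mb pathcomp_idr => ->.
Qed.

Lemma Lmin_disjoint l m : rng l <> rng m -> Lmin l m = set0.
Proof.
move=> lm; rewrite -subset0 => p [lp mp e _]; apply: lm.
by rewrite -(rng_pathcomp lp) e rng_pathcomp.
Qed.

End Paths.

(** * Minimal common extensions with a composite path *)

Section LminComposition.
Variables (k : nat) (L : kgraph k).
Implicit Types (l m n : L).

(** A minimal common extension of [l] and [mn] is cut at the join of the degrees of [l] and [m]. The
    degrees match because, with truncated subtraction, m + max(l - m, n) = max(l, m + n) in each
    coordinate. *)
Lemma Lmin_pathcomp l m n x : src m = rng n ->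
  Lmin l (pathcomp m n) x <->
  exists p q, [/\ Lmin l m p, Lmin p.2 n q & x = (pathcomp p.1 q.1, q.2)].
Proof.
move=> mn; split.
  case: x => a b [/= la]; rewrite src_pathcomp// => nb e d.
  have nb' : src m = rng (pathcomp n b) by rewrite rng_pathcomp.
  have e' : pathcomp l a = pathcomp m (pathcomp n b) by rewrite pathcompA.
  have [[a1 b1] [w [lp /= aw -> nbw]]] := Lmin_common_extension la nb' e'.
  exists (a1, b1), (w, b); split => //; split => //=.
    by rewrite -aw (Lmin_src lp).
  apply/ffunP => i; rewrite -nbw.
  have := congr1 (fun d : degree k => d i) d.
  rewrite e' !deg_pathcomp// !ffunE (Lmin_deg2 i lp) /=; lia.
case=> -[a b] [[c w] [lp lq ->]] /=.
have [/= la mb e _] := lp; have [/= bc nw e' d'] := lq.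
have ac : src a = rng c by rewrite (Lmin_src lp).
split; rewrite /= ?src_pathcomp ?rng_pathcomp//.
  by rewrite pathcompA// e -pathcompA// e' pathcompA.
apply/ffunP => i; have := congr1 (fun d : degree k => d i) d'.
rewrite !deg_pathcomp ?rng_pathcomp//.
rewrite !ffunE (Lmin_deg2 i lp) (Lmin_deg1 i lp) /=; lia.
Qed.

(** This is the disjointness of the union: [p.1] and [p'.1] have the same degree, so equal
    composites have equal initial segments. *)
Lemma Lmin_pathcomp_inj l m n p q p' q' :
  Lmin l m p -> Lmin p.2 n q -> Lmin l m p' -> Lmin p'.2 n q' ->
  pathcomp p.1 q.1 = pathcomp p'.1 q'.1 -> p = p' /\ q = q'.
Proof.
move=> lp lq lp' lq' e.
have pq : src p.1 = rng q.1 by rewrite (Lmin_src lp); case: lq.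
have pq' : src p'.1 = rng q'.1 by rewrite (Lmin_src lp'); case: lq'.
have [|p1 q1] := pathcomp_inj pq pq' _ e.
  by apply/ffunP => i; rewrite (Lmin_deg1 i lp) (Lmin_deg1 i lp').
have pp := Lmin_inj1 lp lp' p1; subst p'.
by have -> := Lmin_inj1 lq lq' q1.
Qed.

Lemma big_Lmin_pathcomp (V : nmodType) (F : L * L -> V) l m n :
  finitely_aligned L -> src m = rng n ->
  \sum_(x \in Lmin l (pathcomp m n)) F x =
  \sum_(p \in Lmin l m) \sum_(q \in Lmin p.2 n) F (pathcomp p.1 q.1, q.2).
Proof.
move=> hL mn; rewrite !fsbig_finite//.
under [RHS]eq_bigr do rewrite fsbig_finite//.
rewrite -(big_allpairs_dep (h := fun p q : L * L => (pathcomp p.1 q.1, q.2))).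
apply: perm_big; apply: uniq_perm => [||x]; first exact: finmap.fset_uniq.
  apply: allpairs_uniq_dep => [|p _|]; try exact: finmap.fset_uniq.
  move=> u u' /allpairsPdep[p [q [+ + ->]]] /allpairsPdep[p' [q' [+ + ->]]].
  rewrite !in_fset_set// !inE => lp lq lp' lq' [+ _].
  by move=> /(Lmin_pathcomp_inj lp lq lp' lq')[-> ->].
rewrite in_fset_set//; apply/idP/allpairsPdep => [|[p [q []]]].
  rewrite inE => /(Lmin_pathcomp _ _ mn)[p [q [lp lq ->]]].
  by exists p, q; rewrite !in_fset_set// !inE.
rewrite !in_fset_set// !inE => lp lq ->.
by apply/(Lmin_pathcomp _ _ mn); exists p, q.
Qed.
End LminComposition.

(** * Arithmetic without a unit, and ordered products *)

Section CstarLemmas.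
Variables (R : realType) (A : cstarAlgType R).
Implicit Types (a b p x y : A).

Lemma cmulr0 a : a ** 0 = 0.
Proof. by apply: (addIr (a ** 0)); rewrite -cmulDr !add0r. Qed.

Lemma cmul0r a : 0 ** a = 0.
Proof. by apply: (addIr (0 ** a)); rewrite -cmulDl !add0r. Qed.

Lemma cmulrN a b : a ** (- b) = - (a ** b).
Proof. by apply: (addIr (a ** b)); rewrite -cmulDr !addNr cmulr0. Qed.

Lemma cmulNr a b : (- a) ** b = - (a ** b).
Proof. by apply: (addIr (a ** b)); rewrite -cmulDl !addNr cmul0r. Qed.

Lemma cmulBr a x y : a ** (x - y) = a ** x - a ** y.
Proof. by rewrite cmulDr cmulrN. Qed.

Lemma cmulBl a x y : (x - y) ** a = x ** a - y ** a.
Proof. by rewrite cmulDl cmulNr. Qed.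

Lemma star0 : (0 : A)^*s = 0.
Proof. by apply: (addIr (0 : A)^*s); rewrite -starD !add0r. Qed.

Lemma star_fsum (I : choiceType) (D : set I) (F : I -> A) : finite_set D ->
  (\sum_(i \in D) F i)^*s = \sum_(i \in D) (F i)^*s.
Proof. by move=> fD; rewrite !fsbig_finite// (big_morph _ (@starD R A) star0). Qed.

Lemma cmul_fsumr (I : choiceType) (D : set I) (F : I -> A) a : finite_set D ->
  a ** (\sum_(i \in D) F i) = \sum_(i \in D) a ** F i.
Proof.
by move=> fD; rewrite !fsbig_finite// (big_morph _ (cmulDr a) (cmulr0 a)).
Qed.

Lemma cmul_fsuml (I : choiceType) (D : set I) (F : I -> A) a : finite_set D ->
  (\sum_(i \in D) F i) ** a = \sum_(i \in D) F i ** a.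
Proof.
move=> fD; rewrite !fsbig_finite//.
by rewrite (big_morph (cmul^~ a) (fun x y => cmulDl x y a) (cmul0r a)).
Qed.

Lemma cmul_seq_fixed (s : seq A) y : s != [::] ->
  (forall f, f \in s -> f ** y = y) -> cmul_seq s ** y = y.
Proof.
case: s => // a s _ sy /=; have ay := sy a (mem_head _ _).
have {}sy f : f \in s -> f ** y = y by move=> fs; apply: sy; rewrite inE fs orbT.
elim: s a ay sy => //= b s IH a ay sy; apply: IH => [|f fs].
  by rewrite -cmulA sy ?mem_head.
by apply: sy; rewrite inE fs orbT.
Qed.

Lemma cmul_seq_fixedl (s : seq A) p : s != [::] ->
  (forall f, f \in s -> p ** f = f) -> p ** cmul_seq s = cmul_seq s.
Proof.
case: s => // a s _ /(_ _ (mem_head _ _)) /=.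
elim: s a => //= b s IH a pa; apply: IH.
by rewrite cmulA pa.
Qed.

(** [p] is moved past the factors up to the one that it annihilates. *)
Lemma cmul_seq_annihilated (s : seq A) p :
  (forall f, f \in s -> p ** f = f ** p) ->
  (exists2 f, f \in s & p ** f = 0) -> p ** cmul_seq s = 0.
Proof.
case: s => [_ [//]|a s]; rewrite /cmul_seq => ps ex.
have foldl0 (u : seq A) b : p ** b = 0 -> p ** foldl cmul b u = 0.
  by elim: u b => //= c u IH b pb; apply: IH; rewrite cmulA pb cmul0r.
elim: s a ps ex => [|b s IH] a ps [f]; first by rewrite inE => /eqP ->.
have pa := ps _ (mem_head _ _).
have pb : p ** b = b ** p by apply: ps; rewrite !inE eqxx orbT.
(* The annihilated factor is the head [a], the next factor [b], or a later one; in the last case the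
   induction continues with [a ** b] as head, which again commutes with [p]. *)
rewrite !inE => /or3P[/eqP -> pf0|/eqP -> pf0|fs pf0] /=.
- by apply: (foldl0 (b :: s)).
- by apply: foldl0; rewrite cmulA pa -cmulA pf0 cmulr0.
- apply: IH; last by exists f; rewrite ?inE ?fs ?orbT.
  move=> g; rewrite inE => /orP[/eqP ->|gs]; last by apply: ps; rewrite !inE gs !orbT.
  by rewrite cmulA pa -!cmulA pb.
Qed.

End CstarLemmas.

(** * Extending the edge values to a multiplicative family *)

Section FamilyExtension.
Variables (R : realType) (k : nat) (L : kgraph k) (A : cstarAlgType R).
Implicit Types (l m n e g : L) (t : L -> A) (y : A).

Lemma multiplicative_family_ext t1 t2 :
  (forall l m, src l = rng m -> t1 l ** t1 m = t1 (pathcomp l m)) ->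
  (forall l m, src l = rng m -> t2 l ** t2 m = t2 (pathcomp l m)) ->
  (forall l : L, edge_or_vertex l -> t1 l = t2 l) -> t1 =1 t2.
Proof.
move=> M1 M2 t12; apply: path_ind => [v|e m ee em IH].
  by apply: t12; exact: edge_or_vertex_idp.
by rewrite -M1// -M2// IH t12//; left.
Qed.

Variable t : L -> A.

(** A relation rather than a function, since a path has several factorisations into edges, each
    giving a candidate value. Products are bracketed to the right and end in a vertex value. *)
Inductive path_value : L -> A -> Prop :=
| path_value_idp v : path_value (idp v) (t (idp v))
| path_value_edge e m a : is_edge e -> src e = rng m ->
    path_value m a -> path_value (pathcomp e m) (t e ** a).

Lemma path_value_exists l : exists a, path_value l a.
Proof.
elim/path_ind: l => [v|e m ee em [a ma]]; first by exists (t (idp v)); constructor.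
by exists (t e ** a); constructor.
Qed.

Lemma path_valueP l a : path_value l a ->
  (exists2 v, l = idp v & a = t (idp v)) \/
  exists e m b, [/\ is_edge e, src e = rng m, path_value m b,
                    l = pathcomp e m & a = t e ** b].
Proof.
by case=> [v|e m b ee em mb]; [left; exists v|right; exists e, m, b].
Qed.

Hypothesis t_square : forall l m a b : L,
  edge_or_vertex l -> edge_or_vertex m -> edge_or_vertex a -> edge_or_vertex b ->
  src l = rng a -> src m = rng b -> pathcomp l a = pathcomp m b ->
  t l ** t a = t m ** t b.

Lemma path_length_idp v : path_length (idp v : L) = 0%N.
Proof. by rewrite /path_length deg_idp big1// => i _; rewrite ffunE. Qed.

(* Two factorisations [e m = e' m'] with distinct first edges are both refined
   by a commuting square [e g = e' h] followed by a common tail [n]. *)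
Lemma path_value_unique l a b : path_value l a -> path_value l b -> a = b.
Proof.
have [N] := ubnP (path_length l); elim: N l a b => // N IH l a b; rewrite ltnS => lN.
case/path_valueP=> [[v lv ->]|[e [m [a' [ee em ma le ->]]]]].
  case/path_valueP=> [[w lw ->]|[e [m [b' [ee em mb le ->]]]]].
    by rewrite -lv -lw.
  by have := path_length_edge ee em; rewrite -le lv path_length_idp.
case/path_valueP=> [[w lw ->]|[e' [m' [b' [ee' em' mb le' ->]]]]].
  by have := path_length_edge ee em; rewrite -le lw path_length_idp.
have lm := path_length_edge ee em; have lm' := path_length_edge ee' em'.
rewrite -le in lm; rewrite -le' in lm'.
have mN : (path_length m < N)%N by rewrite -lm.
have mN' : (path_length m' < N)%N by rewrite -lm'.
have [i ei] := ee; have [j ej] := ee'.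
have e_m : pathcomp e m = pathcomp e' m' by rewrite -le.
have [ij|ij] := eqVneq i j.
  have [|e_e m_m] := pathcomp_inj em em' _ e_m; first by rewrite ei ej ij.
  by subst e' m'; congr (_ ** _); exact: IH mb.
have [p [n [lp pn mn mn']]] := Lmin_common_extension em em' e_m.
have [ep ep' epp _] := lp.
(* Since [i] and [j] differ, the truncated difference of their unit degrees is again a unit degree,
   so the square consists of edges. *)
have p1 : is_edge p.1.
  exists j; apply/ffunP => i'; rewrite (Lmin_deg1 i' lp) ei ej !ffunE.
  by case: eqP => // ->; rewrite eq_sym (negPf ij).
have p2 : is_edge p.2.
  exists i; apply/ffunP => i'; rewrite (Lmin_deg2 i' lp) ei ej !ffunE.
  by case: eqP => // ->; rewrite (negPf ij).
have pn' : src p.2 = rng n by rewrite -(Lmin_src lp).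
have [c nc] := path_value_exists n.
(* The tails [m] and [m'] are shorter than [l], so their values may be computed through the common
   tail [n]. *)
have -> : a' = t p.1 ** c by apply: (IH m) => //; rewrite mn; constructor.
have -> : b' = t p.2 ** c by apply: (IH m') => //; rewrite mn'; constructor.
by rewrite !cmulA (@t_square e e' p.1 p.2)//; left.
Qed.

Definition path_extension l : A := sval (cid (path_value_exists l)).

Lemma path_extensionP l a : path_value l a -> path_extension l = a.
Proof. exact: path_value_unique (svalP (cid (path_value_exists l))). Qed.

Lemma path_extension_idp v : path_extension (idp v) = t (idp v).
Proof. by apply: path_extensionP; constructor. Qed.

Lemma path_extension_edge e m : is_edge e -> src e = rng m ->
  path_extension (pathcomp e m) = t e ** path_extension m.
Proof.
by move=> ee em; apply: path_extensionP; constructor => //;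
  exact: (svalP (cid (path_value_exists m))).
Qed.

Hypothesis t_pi : forall l, edge_or_vertex l -> partial_isometry (t l).
Hypothesis t_vertex : orthogonal_vertex_projections t.
Hypothesis t_edges : forall l m : L, is_edge l -> is_edge m ->
  (t l)^*s ** t m = \sum_(p \in Lmin l m) t p.1 ** (t p.2)^*s.

(** The only minimal extension of [e] with itself is the pair of source vertices, so the sum in
    [t_edges] has one term. *)
Lemma edge_initial_projection e : is_edge e -> (t e)^*s ** t e = t (idp (src e)).
Proof.
move=> ee; rewrite t_edges//.
have -> : Lmin e e = [set (idp (src e), idp (src e))].
  apply/seteqP; split => [p lp|_ ->] /=; last first.
    split; rewrite /= ?rng_idp ?pathcomp_idr//.
    by apply/ffunP => i; rewrite !ffunE maxnn.
  have p1 : deg p.1 = 0.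
    by apply/ffunP => i; rewrite (Lmin_deg1 i lp) subnn ffunE.
  have p2 : deg p.2 = 0.
    by apply/ffunP => i; rewrite (Lmin_deg2 i lp) subnn ffunE.
  case: lp => ep1 ep2 _ _; case: p p1 p2 ep1 ep2 => a b /= /deg0_idp a0 /deg0_idp b0.
  by rewrite a0 b0 !rng_idp => <- <-.
by rewrite fsbig_set1 /=; have [/(_ (src e))[-> ->]] := t_vertex.
Qed.

Lemma edge_source e : is_edge e -> t e ** t (idp (src e)) = t e.
Proof.
by move=> ee; rewrite -edge_initial_projection// cmulA t_pi//; left.
Qed.

Lemma edge_range e : is_edge e -> t (idp (rng e)) ** t e = t e.
Proof.
move=> ee; rewrite -[RHS]edge_source//.
(* The square used is the degenerate one, with range vertex and [e] on one side and [e] and source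
   vertex on the other. *)
apply: t_square; rewrite ?src_idp ?rng_idp ?pathcomp_idl ?pathcomp_idr//;
  by [left|exact: edge_or_vertex_idp].
Qed.

Local Notation u := path_extension.

Lemma path_extension_range l : t (idp (rng l)) ** u l = u l.
Proof.
elim/path_ind: l => [v|e m ee em _].
  by rewrite rng_idp path_extension_idp; have [/(_ v)[]] := t_vertex.
by rewrite path_extension_edge// rng_pathcomp// cmulA edge_range.
Qed.

Lemma path_extensionM l m : src l = rng m -> u l ** u m = u (pathcomp l m).
Proof.
elim/path_ind: l => [v|e l ee el IH].
  by rewrite src_idp => ->; rewrite pathcomp_idl path_extension_idp path_extension_range.
rewrite src_pathcomp// => lm.
have elm : src e = rng (pathcomp l m) by rewrite rng_pathcomp.
by rewrite -pathcompA// !(path_extension_edge ee)// -cmulA IH.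
Qed.

(** The value built for an edge carries the extra factor of its source vertex, which [edge_source]
    absorbs. *)
Lemma path_extension_eq l : edge_or_vertex l -> u l = t l.
Proof.
move=> /edge_or_vertexP[el|[v ->]]; last exact: path_extension_idp.
rewrite -[X in u X]pathcomp_idr path_extension_edge ?rng_idp//.
by rewrite path_extension_idp edge_source.
Qed.

Lemma path_extension_source l : u l ** t (idp (src l)) = u l.
Proof. by rewrite -path_extension_idp path_extensionM ?rng_idp// pathcomp_idr. Qed.

(** The product collapses from the inside: the initial projection of the first edge is the range
    vertex projection of the tail, which the tail absorbs. *)
Lemma path_extension_initial_projection l : (u l)^*s ** u l = t (idp (src l)).
Proof.
elim/path_ind: l => [v|e m ee em IH].
  by rewrite src_idp path_extension_idp; have [/(_ v)[-> ->]] := t_vertex.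
rewrite path_extension_edge// starM cmulA -(cmulA (u m)^*s).
by rewrite edge_initial_projection// em -cmulA path_extension_range IH src_pathcomp.
Qed.

Lemma path_extension_partial_isometry l : partial_isometry (u l).
Proof.
by rewrite /partial_isometry -cmulA path_extension_initial_projection
  path_extension_source.
Qed.

(** * The relation on adjoint products, from edges to all paths *)

Hypothesis hL : finitely_aligned L.

Definition Lmin_relation l m : Prop :=
  (u l)^*s ** u m = \sum_(p \in Lmin l m) u p.1 ** (u p.2)^*s.

(** Taking adjoints swaps the two components of each minimal extension. *)
Lemma Lmin_relation_sym l m : Lmin_relation l m -> Lmin_relation m l.
Proof.
rewrite /Lmin_relation => /(congr1 (@star R A)).
rewrite starM starK => ->; rewrite star_fsum//.
rewrite [RHS](@reindex_fsbig _ _ _ _ _ (fun p => (p.2, p.1)) (Lmin l m)).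
  by apply: eq_fsbigr => p _; rewrite starM starK.
split=> [p /Lmin_sym//|[a b] [c d] _ _ [-> ->]//|p /Lmin_sym lp].
by exists (p.2, p.1) => //; case: (p).
Qed.

(** Expanding first against [m], then each [p.2] against [n], produces the double sum of
    [big_Lmin_pathcomp]. *)
Lemma Lmin_relation_pathcomp l m n : src m = rng n ->
  Lmin_relation l m -> (forall p, Lmin l m p -> Lmin_relation p.2 n) ->
  Lmin_relation l (pathcomp m n).
Proof.
move=> mn lm ln; rewrite /Lmin_relation big_Lmin_pathcomp// -path_extensionM//.
rewrite cmulA lm cmul_fsuml//; apply: eq_fsbigr => p; rewrite inE => lp.
rewrite -cmulA (ln p lp) cmul_fsumr//; apply: eq_fsbigr => q; rewrite inE => -[pq _ _ _].
by rewrite cmulA path_extensionM// (Lmin_src lp).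
Qed.

Lemma Lmin_relation_idp v m : Lmin_relation (idp v) m.
Proof.
have [tp to] := t_vertex; rewrite /Lmin_relation path_extension_idp (tp v).1.
have [->|vm] := pselect (v = rng m).
  rewrite path_extension_range Lmin_idp fsbig_set1 /= path_extension_idp.
  by rewrite (tp _).1 path_extension_source.
rewrite Lmin_disjoint ?rng_idp// fsbig_set0.
by rewrite -path_extension_range cmulA to// cmul0r.
Qed.

(** Splitting an edge off [m] replaces [l] by second components [p.2]. These may be vertices even
    when [l] is an edge, but nothing longer, so the class of edges and vertices is stable under the
    induction. *)
Lemma Lmin_relation_edge_or_vertex l m : edge_or_vertex l -> Lmin_relation l m.
Proof.
elim/path_ind: m l => [v l _|e m ee em IH l el].
  by apply: Lmin_relation_sym; exact: Lmin_relation_idp.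
apply: Lmin_relation_pathcomp => // [|p lp]; last first.
  by apply: IH; exact: Lmin_edge_or_vertex2 el lp.
have ee' : edge_or_vertex e by left.
have /edge_or_vertexP[le|[v ->]] := el; last exact: Lmin_relation_idp.
rewrite /Lmin_relation !path_extension_eq// t_edges//.
apply: eq_fsbigr => p; rewrite inE => lp.
rewrite !path_extension_eq//; first exact: Lmin_edge_or_vertex2 el lp.
exact: Lmin_edge_or_vertex1 ee' lp.
Qed.

(** Symmetry puts [l] on the right, where its first edge can be split off; the induction hypothesis
    is then needed at the arbitrary paths [p.2], hence for all [m]. *)
Lemma path_extension_Lmin l m : Lmin_relation l m.
Proof.
elim/path_ind: l m => [v m|e l ee el IH m]; first exact: Lmin_relation_idp.
apply: Lmin_relation_sym; apply: Lmin_relation_pathcomp => // [|p _].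
  by apply: Lmin_relation_sym; apply: Lmin_relation_edge_or_vertex; left.
exact: Lmin_relation_sym.
Qed.

End FamilyExtension.

(** * Exhaustive sets and the vanishing of gap products *)

Section GapProducts.
Variables (R : realType) (k : nat) (L : kgraph k) (A : cstarAlgType R).
Implicit Types (l m g : L) (v : vertex L) (y : A).

Definition first_edges (E : set L) : set L :=
  [set g | is_edge g /\
     exists l m, [/\ E l, src g = rng m & l = pathcomp g m]].

(** The set usually written Ext(g; E). *)
Definition minimal_extensions g (E : set L) : set L :=
  \bigcup_(l in E) fst @` Lmin g l.

(** By unique factorisation a path has at most one initial edge of each of the k unit degrees. *)
Lemma finite_first_edges E : finite_set E -> finite_set (first_edges E).
Proof.
move=> fE; pose S l i := [set g | deg g = unit_degree i /\
  exists2 m, src g = rng m & l = pathcomp g m].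
apply: (@sub_finite_set _ _ (\bigcup_(l in E) \bigcup_(i in setT) S l i)).
  move=> g [[i gi] [l [m [El gm lgm]]]].
  by exists l => //; exists i => //; split => //; exists m.
apply: bigcup_finite => // l _; apply: bigcup_finite => [|i _]; first exact: finite_finset.
have [[g Sg]|nS] := pselect (exists g, S l i g); last first.
  suff -> : S l i = set0 by [].
  by rewrite -subset0 => g Sg; apply: nS; exists g.
apply: (@sub_finite_set _ _ [set g]) => // h [hi [m hm e]].
have [gi [m' gm' e']] := Sg.
by have [||-> _] := pathcomp_inj hm gm' _ _ => //; rewrite ?hi ?gi// -e -e'.
Qed.

(** A common extension of [l] and [m] also extends any first edge of [l]; a path without one would
    be the vertex [idp v]. *)
Lemma exhaustive_first_edges v (E : set L) : exhaustive v E -> ~ E (idp v) ->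
  exhaustive v (first_edges E).
Proof.
move=> [rE exE] nEv; split=> [g [_ [l [m [El gm le]]]]|m mv].
  by rewrite -(rE l El) le rng_pathcomp.
have [l El [[a b] [/= la mb e _]]] := exE m mv.
have [l0|] := pselect (forall i, deg l i = 0%N).
  case: nEv; rewrite -(rE l El) -(deg0_idp (l := l))//.
  by apply/ffunP => i; rewrite l0 ffunE.
move=> /existsNP[i /eqP]; rewrite -lt0n => /first_edge[g [n [gi gn lgn]]].
exists g; first by split; [exists i|exists l, n].
have na : src n = rng a by rewrite -la lgn src_pathcomp.
have [||p [_ [gp _ _ _]]] := @Lmin_common_extension _ _ g m (pathcomp n a) b _ mb.
- by rewrite rng_pathcomp.
- by rewrite pathcompA// -lgn.
by exists p.
Qed.

(** Exhaustiveness of [E] is tested on [gm]: a common extension of [gm] and some [l] in [E] factors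
    through a minimal one of [g] and [l], and cancelling [g] leaves a common extension of [p.1] and
    [m]. *)
Lemma exhaustive_minimal_extensions g (E : set L) : exhaustive (rng g) E ->
  exhaustive (src g) (minimal_extensions g E).
Proof.
move=> [_ exE]; split=> [a [l El [p [gp _ _ _] <-]] //|m mg].
have gm : src g = rng m by [].
have [|l El [[a b] [/= la gmb e _]]] := exE (pathcomp g m).
  by rewrite rng_pathcomp.
rewrite src_pathcomp// in gmb.
have gmb' : src g = rng (pathcomp m b) by rewrite rng_pathcomp.
have [|p [w [gp pw mbw aw]]] := Lmin_common_extension gmb' la.
  by rewrite pathcompA.
exists p.1; first by exists l => //; exists p.
by have [q [_ [pq _ _ _]]] := Lmin_common_extension pw gmb (esym mbw); exists q.
Qed.

Lemma finite_minimal_extensions g (E : set L) : finitely_aligned L ->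
  finite_set E -> finite_set (minimal_extensions g E).
Proof.
by move=> hL fE; apply: bigcup_finite => // l _; apply: finite_image; exact: hL.
Qed.

Variable t : L -> A.
Hypothesis t_vertex : orthogonal_vertex_projections t.
Hypothesis tM : forall l m, src l = rng m -> t l ** t m = t (pathcomp l m).

Lemma star_path_source g y : t (idp (src g)) ** ((t g)^*s ** y) = (t g)^*s ** y.
Proof.
have [/(_ (src g))[tg _] _] := t_vertex.
by rewrite -{1}tg cmulA -starM tM ?rng_idp// pathcomp_idr.
Qed.

Lemma gap_product_fixed v (E : seq L) y : E != [::] ->
  t (idp v) ** y = y -> (forall l, l \in E -> (t l)^*s ** y = 0) ->
  gap_product t v E ** y = y.
Proof.
move=> E0 vy Ey; apply: cmul_seq_fixed; first by case: (E) E0.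
by move=> _ /mapP[l lE ->]; rewrite cmulBl vy -cmulA Ey// cmulr0 subr0.
Qed.

(** Some member must meet [idp v]. This keeps the dummy value 0 of the empty product out of play. *)
Lemma exhaustive_neq0 v (E : seq L) : exhaustive v [set` E] -> E != [::].
Proof.
move=> [_ exE]; have [l] := exE (idp v) (rng_idp v).
by rewrite /=; case: (E).
Qed.

Hypothesis t_gap : forall v (E : seq L), uniq E ->
  (forall l, l \in E -> rng l = v /\ is_edge l) ->
  exhaustive v [set` E] -> gap_product t v E = 0.

(** The bound [M] is explicit because the induction is on its coordinate sum: passing to the minimal
    extensions of a first edge of degree e_i lowers coordinate [i] by one. *)
Lemma exhaustive_annihilator_bounded (M : degree k) v (E : set L) y :
  finitely_aligned L -> finite_set E -> exhaustive v E ->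
  (forall l i, E l -> (deg l i <= M i)%N) ->
  t (idp v) ** y = y -> (forall l, E l -> (t l)^*s ** y = 0) -> y = 0.
Proof.
move=> hL; have [N] := ubnP (\sum_i M i)%N.
elim: N M v E y => // N IH M v E y; rewrite ltnS => MN fE exE EM vy Ey.
(* If the vertex lies in [E], the annihilation at [idp v] reads [y = 0]. *)
have [Ev|nEv] := pselect (E (idp v)).
  by have := Ey _ Ev; have [/(_ v)[-> _] _] := t_vertex; rewrite vy.
have exI := exhaustive_first_edges exE nEv.
have /finite_seqP[s Is] := finite_first_edges fE.
have Is' : first_edges E = [set` undup s].
  by rewrite Is; apply/seteqP; split=> g /=; rewrite mem_undup.
have Ig g : g \in undup s -> first_edges E g by rewrite Is'.
have sy g : g \in undup s -> (t g)^*s ** y = 0.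
  move=> /Ig Eg; have [[i gi] [l [m [El gm lgm]]]] := Eg.
  (* Positivity makes the truncated subtraction below a strict decrease. *)
  have Mi : (0 < M i)%N.
    apply: leq_trans (EM l i El).
    by rewrite lgm deg_pathcomp// degree_addE gi ffunE eqxx.
  have gv : rng g = v by have [rI _] := exI; exact: rI.
  apply: (IH [ffun j => M j - unit_degree i j]%N (src g) (minimal_extensions g E)).
  - apply: leq_trans MN; rewrite (bigD1 i)//= [ltnRHS](bigD1 i)//= !ffunE eqxx.
    rewrite -addSn; apply: leq_add; first by rewrite -subSn// subn1.
    by apply: leq_sum => j _; rewrite ffunE leq_subr.
  - exact: finite_minimal_extensions.
  - by apply: exhaustive_minimal_extensions; rewrite gv.
  - move=> _ j [l' El' [p gp <-]]; rewrite (Lmin_deg1 j gp) gi [leqRHS]ffunE.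
    exact: leq_sub2r (EM l' j El').
  - exact: star_path_source.
  (* As [g p.1 = l' p.2], the adjoint of [t] at [g p.1] passes through that of [t l'], which kills
     [y]. *)
  - move=> _ [l' El' [p [gp lp e _] <-]].
    by rewrite cmulA -starM tM// e -tM// starM -cmulA Ey// cmulr0.
have exs : exhaustive v [set` undup s] by rewrite -Is'.
(* The gap product over the first edges fixes [y], yet it vanishes by [t_gap]. *)
have := gap_product_fixed (exhaustive_neq0 exs) vy sy.
rewrite t_gap ?undup_uniq// ?cmul0r// => g /Ig Eg.
by split; [have [rI _] := exI; exact: rI|case: Eg].
Qed.

Lemma exhaustive_annihilator v (E : seq L) y :
  finitely_aligned L -> exhaustive v [set` E] ->
  t (idp v) ** y = y -> (forall l, l \in E -> (t l)^*s ** y = 0) -> y = 0.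
Proof.
move=> hL exE; pose M := [ffun i => \max_(l <- E) deg l i] : degree k.
apply: (@exhaustive_annihilator_bounded M v [set` E]) => // l i lE.
by rewrite ffunE; exact: (@leq_bigmax_seq _ E xpredT (fun l : L => deg l i)).
Qed.

Hypothesis hL : finitely_aligned L.
Hypothesis t_pi : forall l, partial_isometry (t l).
Hypothesis t_Lmin : forall l m,
  (t l)^*s ** t m = \sum_(p \in Lmin l m) t p.1 ** (t p.2)^*s.

(** The product is the sum of the range projections of the minimal common extensions, hence
    self-adjoint; two self-adjoint elements with self-adjoint product commute. *)
Lemma range_projections_commute l m :
  (t l ** (t l)^*s) ** (t m ** (t m)^*s) = (t m ** (t m)^*s) ** (t l ** (t l)^*s).
Proof.
set q := LHS.
suff qq : q^*s = q by rewrite -qq !starM !starK.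
have -> : q = \sum_(p \in Lmin l m) t (pathcomp l p.1) ** (t (pathcomp l p.1))^*s.
  rewrite /q cmulA -(cmulA (t l)) t_Lmin cmul_fsumr// cmul_fsuml//.
  apply: eq_fsbigr => p; rewrite inE => -[lp mp e _].
  by rewrite -cmulA -(cmulA (t p.1)) -starM tM// -e cmulA tM.
by rewrite star_fsum//; apply: eq_fsbigr => p _; rewrite starM starK.
Qed.

(** The annihilator criterion is applied to the gap product itself: each range projection commutes
    with all factors and kills its own. *)
Lemma gap_product_exhaustive v (E : seq L) : exhaustive v [set` E] ->
  gap_product t v E = 0.
Proof.
move=> exE; have [rE _] := exE; have [/(_ v)[tv tvv] _] := t_vertex.
have range l : l \in E -> t (idp v) ** t l = t l.
  by move=> /rE lv; rewrite tM ?src_idp// -lv pathcomp_idl.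
apply: (exhaustive_annihilator hL exE) => [|l lE].
  apply: cmul_seq_fixedl => [|_ /mapP[l lE ->]].
    by have := exhaustive_neq0 exE; case: (E).
  by rewrite cmulBr tvv cmulA range.
have -> : (t l)^*s = (t l)^*s ** (t l ** (t l)^*s).
  by rewrite -{1}(t_pi l) !starM starK.
rewrite -cmulA [X in _ ** X]cmul_seq_annihilated ?cmulr0// => [_ /mapP[m mE ->]|].
  rewrite cmulBr cmulBl range_projections_commute; congr (_ - _).
  by rewrite cmulA range// -cmulA -{1}tv -starM range.
exists (t (idp v) - t l ** (t l)^*s); first by apply/mapP; exists l.
rewrite cmulBr -cmulA -{1}tv -starM range//.
by rewrite cmulA t_pi subrr.
Qed.

End GapProducts.

(** * Uniqueness, and transfer of the relations between edges and paths *)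

Theorem theoremC1 (R : realType) (k : nat) (L : kgraph k) (A : cstarAlgType R)
    (hL : finitely_aligned L) (t : L -> A)
    (ht : forall l : L, edge_or_vertex l -> partial_isometry (t l)) :
  (forall t1 t2 : L -> A,
     cuntz_krieger_family t1 -> (forall l, edge_or_vertex l -> t1 l = t l) ->
     cuntz_krieger_family t2 -> (forall l, edge_or_vertex l -> t2 l = t l) ->
     forall l, t1 l = t2 l)
  /\
  ((exists t' : L -> A,
      cuntz_krieger_family t' /\ (forall l, edge_or_vertex l -> t' l = t l))
   <->
   [/\ orthogonal_vertex_projections t,
       forall l m a b : L,
         edge_or_vertex l -> edge_or_vertex m ->
         edge_or_vertex a -> edge_or_vertex b ->
         src l = rng a -> src m = rng b -> pathcomp l a = pathcomp m b ->
         t l ** t a = t m ** t b,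
       forall l m : L, is_edge l -> is_edge m ->
         (t l)^*s ** t m = \sum_(p \in Lmin l m) t p.1 ** (t p.2)^*s
     & forall (v : vertex L) (E : seq L), uniq E ->
         (forall l, l \in E -> rng l = v /\ is_edge l) ->
         exhaustive v [set` E] ->
         gap_product t v E = 0]).
Proof.
split=> [t1 t2 [_ [_ M1 _ _]] e1 [_ [_ M2 _ _]] e2|].
  by apply: multiplicative_family_ext => // l el; rewrite e1// e2.
have vertexE t1 t2 : (forall l : L, edge_or_vertex l -> t1 l = t2 l :> A) ->
    orthogonal_vertex_projections t1 -> orthogonal_vertex_projections t2.
  move=> e [p o]; have ev v := e _ (edge_or_vertex_idp v).
  by split=> [v|v w]; rewrite -!ev; [exact: p|exact: o].
have gapE t1 t2 v (E : seq L) :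
    (forall l : L, edge_or_vertex l -> t1 l = t2 l :> A) ->
    (forall l, l \in E -> is_edge l) -> gap_product t1 v E = gap_product t2 v E.
  move=> e Ee; congr cmul_seq; apply/eq_in_map => l lE.
  by rewrite !e//; [left; exact: Ee|exact: edge_or_vertex_idp].
split=> [[t' [[pi [V M C G]] e]]|[V S C G]].
  split=> [|l m a b el em ea eb la mb lamb|l m el em|v E uE Ee exE].
  - exact: vertexE e V.
  - by rewrite -!e// !M// lamb.
  (* Minimal extensions of two edges have edges or vertices as components, so the sum only involves
     values where [t'] and [t] agree. *)
  - have [el' em'] : edge_or_vertex l /\ edge_or_vertex m by split; left.
    rewrite -!e// C; apply: eq_fsbigr => p; rewrite inE => lp.
    rewrite !e//; first exact: Lmin_edge_or_vertex2 el' lp.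
    exact: Lmin_edge_or_vertex1 em' lp.
  - by rewrite -(gapE t') ?G// => l /Ee[].
have tE := path_extension_eq S ht V C.
exists (path_extension t); split=> //; split.
  exact: path_extension_partial_isometry.
have V' : orthogonal_vertex_projections (path_extension t).
  by apply: vertexE V => l el; rewrite tE.
split=> // [||v E uE exE].
- exact: path_extensionM.
- exact: path_extension_Lmin.
- apply: gap_product_exhaustive exE => //.
  + exact: path_extensionM.
  + by move=> w F uF Fe exF; rewrite (gapE _ t) ?G// => l /Fe[].
  + exact: path_extension_partial_isometry.
  + exact: path_extension_Lmin.
Qed.
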